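(* Let $F:\mathbb{R}^{10}\to\mathbb{R}$ be the quartic form $$\begin{aligned}F(x_1,\dots,x_{10})=\Big(\sum_{i=1}^{10}x_i^2\Big)^2-8\Big\{&(x_5x_{10}-x_6x_9+x_7x_8)^2+(-x_2x_{10}+x_3x_9-x_4x_8)^2\\&+(x_1x_{10}-x_3x_7+x_4x_6)^2+(-x_1x_9+x_2x_7-x_4x_5)^2+(x_1x_8-x_2x_6+x_3x_5)^2\Big\},\end{aligned}$$ and let $M_-=\{x\in\mathbb{S}^9 : F(x)=-1\}$. Then any quadratic form $Q=Q(x_1,\dots,x_{10})$ vanishing on $M_-$ is identically zero. In particular, $M_-$ is not quadratic and the positive semidefinite form $G_F^+(x)=|x|^4+F(x)$ on $\mathbb{R}^{10}$ is not a sum of squares of real polynomials.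
   Context: $F$ is the isoparametric polynomial with $g=4$, $(m_+,m_-)=(2,2)$; $\mathbb{S}^9$ is the unit sphere in $\mathbb{R}^{10}$, and $-|x|^4\le F(x)\le |x|^4$, so $M_-$ is the set of zeroes of $G_F^+$ on $\mathbb{S}^9$. A subset of the unit sphere is called quadratic if it is the intersection of the sphere with the common zero set of a family of real quadratic forms. A quadratic form is a real homogeneous polynomial of degree 2. *)

(* Defs.v *)
From mathcomp Require Import all_boot all_order all_algebra.
From mathcomp Require Import mpoly.
From mathcomp Require Import classical_sets reals.

Set Implicit Arguments.
Unset Strict Implicit.
Unset Printing Implicit Defensive.

Import Order.TTheory GRing.Theory Num.Theory.
Local Open Scope classical_set_scope.
Local Open Scope ring_scope.

Definition unit_sphere (R : realType) (n : nat) : set 'rV[R]_n :=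
  [set x : 'rV[R]_n | \sum_(i < n) x ord0 i ^+ 2 = 1].

(* [2.-homog] contains the zero polynomial, so the zero form counts as a
   quadratic form. *)
Definition quadratic_form (R : realType) (n : nat) (Q : {mpoly R[n]}) : Prop :=
  Q \is 2.-homog.

Definition vanishes_on (R : realType) (n : nat) (Q : {mpoly R[n]})
    (S : set 'rV[R]_n) : Prop :=
  forall x : 'rV[R]_n, S x -> Q.@[x ord0] = 0.

(* The family of quadratic forms is arbitrary: possibly empty or infinite. *)
Definition quadratic_set (R : realType) (n : nat) (S : set 'rV[R]_n) : Prop :=
  exists A : set {mpoly R[n]},
    (forall Q, A Q -> quadratic_form Q) /\
    S = @unit_sphere R n `&` [set x : 'rV[R]_n | forall Q, A Q -> Q.@[x ord0] = 0].

Definition psd_form (R : realType) (n d : nat) (p : {mpoly R[n]}) : Prop :=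
  p \is d.-homog /\ forall x : 'rV[R]_n, 0 <= p.@[x ord0].

Definition is_sos (R : realType) (n : nat) (p : {mpoly R[n]}) : Prop :=
  exists s : seq {mpoly R[n]}, p = \sum_(q <- s) q ^+ 2.

(* |x|^2 *)
Definition sqnorm (R : realType) (n : nat) : {mpoly R[n]} :=
  \sum_(i < n) 'X_i ^+ 2.

(* The coordinates x_1, ..., x_10, numbered from 1: only used for 1 <= k <= 10. *)
Definition x_ (R : realType) (k : nat) : {mpoly R[10]} := 'X_(inord k.-1).
Arguments x_ {R} k%_N.

Definition isoF (R : realType) : {mpoly R[10]} :=
  sqnorm R 10 ^+ 2 - 8%:R *
    ((x_ 5 * x_ 10 - x_ 6 * x_ 9 + x_ 7 * x_ 8) ^+ 2
     + (- x_ 2 * x_ 10 + x_ 3 * x_ 9 - x_ 4 * x_ 8) ^+ 2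
     + (x_ 1 * x_ 10 - x_ 3 * x_ 7 + x_ 4 * x_ 6) ^+ 2
     + (- x_ 1 * x_ 9 + x_ 2 * x_ 7 - x_ 4 * x_ 5) ^+ 2
     + (x_ 1 * x_ 8 - x_ 2 * x_ 6 + x_ 3 * x_ 5) ^+ 2).

Definition Mminus (R : realType) : set 'rV[R]_10 :=
  @unit_sphere R 10 `&`
  [set x : 'rV[R]_10 | (isoF R).@[x ord0] = -1].

Definition GFplus (R : realType) : {mpoly R[10]} := sqnorm R 10 ^+ 2 + isoF R.

(* Main.v *)
(* Read [x] as the Pluecker coordinates of a 2-form [w] on R^5, with n = |w|^2
   and p the squared norm of the vector of 4x4 Pfaffians, so that
   G_F^+ = 2 (n^2 - 4 p) and the cone over M_- is n^2 = 4 p. It contains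
   e_p + e_r and e_p - e_r for disjoint pairs p, r, and 4 e_p + 3 e_s + 5 e_r
   for distinct pairs p, s both disjoint from r. Disjointness of pairs is the
   Petersen graph, so a quadratic form B vanishing on the cone has B_pr = 0 and
   B_pp = - B_rr along edges; a 5-cycle then kills the diagonal, and the third
   kind of points kills B_ps, because the Petersen graph has diameter 2.
   If G_F^+ were a sum of squares, comparing lowest-order terms along rays would
   make it the sum of the squares of the degree 2 parts; these vanish on M_-,
   hence are zero. *)
From HB Require Import structures.
Require Import Defs.
From mathcomp Require Import all_boot all_order all_algebra.
From mathcomp Require Import mpoly.
From mathcomp Require Import classical_sets reals.
From mathcomp Require Import ring lra.

Set Implicit Arguments.
Unset Strict Implicit.
Unset Printing Implicit Defensive.

Import Order.TTheory GRing.Theory Num.Theory.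
Local Open Scope ring_scope.

(** * Quadratic forms and symmetric matrices *)

Lemma mdeg2P (n : nat) (m : 'X_{1..n}) :
  mdeg m = 2 -> exists i j, m = (U_(i) + U_(j))%MM.
Proof.
move=> m2.
have [i mi0] : exists i, m i != 0%N.
  apply/existsP; rewrite -negb_forall; apply/negP => /forallP m0.
  by move: m2; rewrite mdegE big1 // => i _; exact/eqP/m0.
have le_im : (U_(i) <= m)%MM by rewrite lep1mP.
have /mdeg1P[j /eqP mj] : mdeg (m - U_(i))%MM == 1%N.
  by rewrite -(eqn_add2r 1) -{1}(mdeg1 i) -mdegD submK // m2.
by exists j, i; rewrite -mj submK.
Qed.

Section SymmetricMatrix.
Variables (R : numFieldType) (n : nat).
Implicit Types (B : 'M[R]_n) (x : 'rV[R]_n).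

Definition mx_form B : {mpoly R[n]} := \sum_i \sum_j B i j *: ('X_i * 'X_j).

Lemma mx_formD B C : mx_form (B + C) = mx_form B + mx_form C.
Proof.
rewrite /mx_form -big_split; apply: eq_bigr => i _.
by rewrite -big_split; apply: eq_bigr => j _; rewrite mxE scalerDl.
Qed.

Lemma mx_formZ a B : mx_form (a *: B) = a *: mx_form B.
Proof.
rewrite /mx_form scaler_sumr; apply: eq_bigr => i _.
by rewrite scaler_sumr; apply: eq_bigr => j _; rewrite mxE scalerA.
Qed.

Lemma mx_form0 : mx_form 0 = 0.
Proof. by rewrite -(scale0r 0) mx_formZ scale0r. Qed.

Lemma mx_form_delta i j : mx_form (delta_mx i j) = 'X_i * 'X_j.
Proof.
rewrite /mx_form (bigD1 i) //= (bigD1 j) //= mxE !eqxx scale1r.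
rewrite big1 ?addr0 => [|k /negbTE kj]; last by rewrite mxE kj andbF scale0r.
rewrite big1 ?addr0 // => l /negbTE li.
by rewrite big1 // => k _; rewrite mxE li scale0r.
Qed.

(** Each monomial ['X_i * 'X_j] is the form of half of [delta_mx i j + delta_mx j i], and symmetric
    matrices are closed under sums and scaling. *)
Lemma homog2_mx_form (Q : {mpoly R[n]}) :
  Q \is 2.-homog -> exists2 B, B^T = B & Q = mx_form B.
Proof.
move=> /dhomogP Qh; rewrite [Q]mpolyE big_seq.
apply: (big_ind (fun P => exists2 B, B^T = B & P = mx_form B)).
- by exists 0; rewrite ?trmx0 ?mx_form0.
- move=> _ _ [B Bs ->] [C Cs ->]; exists (B + C); last by rewrite mx_formD.
  by rewrite linearD /= Bs Cs.
move=> m /Qh /mdeg2P[i [j ->]].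
exists (Q@_(U_(i) + U_(j)) *: (2^-1 *: (delta_mx i j + delta_mx j i))).
  rewrite linearZ /= [(2^-1 *: _)^T]linearZ linearD /= !trmx_delta.
  by rewrite [delta_mx j i + _]addrC.
rewrite !mx_formZ mx_formD !mx_form_delta mpolyXD [X in _ + X]mulrC.
congr (_ *: _).
by rewrite -mulr2n -scaler_nat scalerA mulVf ?pnatr_eq0 // scale1r.
Qed.

Lemma meval_mx_form B x : (mx_form B).@[x ord0] = (x *m B *m x^T) ord0 ord0.
Proof.
rewrite /mx_form exchange_big raddf_sum mxE /=; apply: eq_bigr => i _.
rewrite raddf_sum /= mxE mulr_suml; apply: eq_bigr => j _.
by rewrite mevalZ mevalM !mevalXU !mxE; ring.
Qed.

Lemma mx_formZr B a x :
  ((a *: x) *m B *m (a *: x)^T) ord0 ord0 = a ^+ 2 * (x *m B *m x^T) ord0 ord0.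
Proof.
by rewrite linearZ /= -!scalemxAl -scalemxAr !mxE mulrA.
Qed.

(** Bilinear expansion, valid also when some of the indices [p], [s], [r] coincide. *)
Lemma mx_form3 B (a b c : R) (p s r : 'I_n) : B^T = B ->
  let x : 'rV_n :=
    a *: delta_mx ord0 p + b *: delta_mx ord0 s + c *: delta_mx ord0 r in
  (x *m B *m x^T) ord0 ord0 = a ^+ 2 * B p p + b ^+ 2 * B s s + c ^+ 2 * B r r
    + 2 * (a * b * B p s + a * c * B p r + b * c * B s r).
Proof.
move=> Bs x.
have BC i j : B i j = B j i by rewrite -{1}Bs mxE.
pose e i : 'rV[R]_n := delta_mx ord0 i.
have E i j : (e i *m B *m (e j)^T) ord0 ord0 = B i j.
  by rewrite /e trmx_delta -rowE -colE !mxE.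
rewrite /x !linearD !linearZ /= !(mulmxDl, mulmxDr) -!(scalemxAl, scalemxAr).
have addE (M N : 'M[R]_1) : (M + N) ord0 ord0 = M ord0 ord0 + N ord0 ord0.
  by rewrite mxE.
have scaleE k (M : 'M[R]_1) : (k *: M) ord0 ord0 = k * M ord0 ord0.
  by rewrite mxE.
rewrite !(addE, scaleE, E) (BC s p) (BC r p) (BC r s); ring.
Qed.

End SymmetricMatrix.

(** * Sums of squares restricted to rays *)

Lemma coef_sum_sqr (R : realFieldType) (s : seq {poly R}) (c : R) d :
  \sum_(p <- s) p ^+ 2 = c *: 'X^(d.*2) -> \sum_(p <- s) p`_d ^+ 2 = c.
Proof.
have coef0_sum (t : seq {poly R}) :
    \sum_(p <- t) p`_0 ^+ 2 = (\sum_(p <- t) p ^+ 2)`_0.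
  by rewrite coef_sum; apply: eq_bigr => p _; rewrite !expr2 coef0M.
elim: d s => [|d IHd] s E.
  by rewrite coef0_sum E coefZ coefXn mulr1.
(* Squares with sum zero vanish, so every [p] is divisible by ['X]; cancelling ['X ^+ 2] lowers [d]
   by one. *)
have p0 p : p \in s -> p`_0 = 0.
  move=> ps; apply/eqP; rewrite -sqrf_eq0.
  have /eqP : \sum_(q <- s) q`_0 ^+ 2 = 0.
    by rewrite coef0_sum E coefZ coefXn mulr0.
  by rewrite psumr_eq0 => [/allP/(_ p ps)|q _]; rewrite ?sqr_ge0.
have pX p : p \in s -> p = drop_poly 1 p * 'X.
  by move=> ps; apply/polyP => -[|k]; rewrite coefMX ?coef_drop_poly ?addn1 ?p0.
have /IHd : \sum_(p <- map (drop_poly 1) s) p ^+ 2 = c *: 'X^(d.*2).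
  rewrite big_map; apply: (@mulIf _ ('X ^+ 2 : {poly R})).
    by rewrite expf_neq0 ?polyX_eq0.
  rewrite -scalerAl -exprD addn2 -doubleS -E mulr_suml.
  by apply: eq_big_seq => p /pX {2}->; rewrite exprMn.
rewrite big_map => <-; apply: eq_bigr => p _.
by rewrite coef_drop_poly addn1.
Qed.

Section Rays.
Variables (R : realFieldType) (n : nat).
Implicit Types (p q : {mpoly R[n]}) (x : 'I_n -> R).

Definition ray x : {mpoly R[n]} -> {poly R} := mmap polyC (fun i => x i *: 'X).

HB.instance Definition _ x := GRing.RMorphism.on (ray x).

Lemma coef_ray x p d : (ray x p)`_d = (pihomog mdeg d p).@[x].
Proof.
rewrite /ray /mmap coef_sum /pihomog raddf_sum /= [RHS]big_mkcond /=.
apply: eq_bigr => m _.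
have -> : mmap1 (fun i => x i *: 'X) m = ('X_[m]).@[x] *: 'X^(mdeg m).
  rewrite mevalX /mmap1 mdegE.
  rewrite (eq_bigr (fun i => x i ^+ m i *: 'X^(m i))) => [|i _].
    by rewrite scaler_prod prodrXr.
  by rewrite exprZn.
rewrite coefCM coefZ coefXn eq_sym.
by case: eqP => _; rewrite ?mevalZ ?mulr1 ?mulr0.
Qed.

Lemma ray_homog x p d : p \is d.-homog -> ray x p = p.@[x] *: 'X^d.
Proof.
move=> ph; apply/polyP => k; rewrite coef_ray coefZ coefXn.
case: eqP => [->|/eqP kd]; first by rewrite (pihomog_dE ph) mulr1.
by rewrite (pihomog_ne0 _ ph) 1?eq_sym // meval0 mulr0.
Qed.

(** On the line through [x], the homogeneous [p] becomes the monomial [p.@[x] *: 'X^(d.*2)], so no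
    summand has terms below degree [d] there and only the coefficients of degree [d] contribute. *)
Lemma sos_homog p (s : seq {mpoly R[n]}) d x :
  p \is d.*2.-homog -> p = \sum_(q <- s) q ^+ 2 ->
  p.@[x] = \sum_(q <- s) (pihomog mdeg d q).@[x] ^+ 2.
Proof.
move=> ph pE; have := ray_homog x ph.
rewrite pE rmorph_sum -pE /= => E.
have /coef_sum_sqr : \sum_(u <- map (ray x) s) u ^+ 2 = p.@[x] *: 'X^(d.*2).
  by rewrite big_map -E; apply: eq_bigr => q _; rewrite rmorphXn.
by rewrite big_map => <-; apply: eq_bigr => q _; rewrite coef_ray.
Qed.

End Rays.

(** * The Pfaffian inequality *)

Definition sqn (T : comNzRingType) (x : nat -> T) : T :=
  x 0 ^+ 2 + x 1 ^+ 2 + x 2 ^+ 2 + x 3 ^+ 2 + x 4 ^+ 2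
  + x 5 ^+ 2 + x 6 ^+ 2 + x 7 ^+ 2 + x 8 ^+ 2 + x 9 ^+ 2.

(** The i-th square comes from the Pfaffian, up to sign, of the skew 5x5 matrix with row and column
    i deleted. *)
Definition pfaffians_sqn (T : comNzRingType) (x : nat -> T) : T :=
  (x 4 * x 9 - x 5 * x 8 + x 6 * x 7) ^+ 2
  + (- x 1 * x 9 + x 2 * x 8 - x 3 * x 7) ^+ 2
  + (x 0 * x 9 - x 2 * x 6 + x 3 * x 5) ^+ 2
  + (- x 0 * x 8 + x 1 * x 6 - x 3 * x 4) ^+ 2
  + (x 0 * x 7 - x 1 * x 5 + x 2 * x 4) ^+ 2.

(** Boolean and over any ring, so that integer points are checked by computation and then mapped to
    the reals. *)
Definition on_cone (T : comNzRingType) (x : nat -> T) : bool :=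
  sqn x ^+ 2 == 4 * pfaffians_sqn x.

(* With [w] the 2-form of coordinates [x] and [W] the Hodge dual of [w /\ v],
   [|W|^2 + |i_v w|^2 = |v|^2 |w|^2]. For [v] the vector of Pfaffians,
   [i_v w = 0] and [<w, W> = 2 |v|^2], and the inequality is
   [|t w - W|^2 >= 0] at [t = |w|^2 / 2]. *)
Lemma pfaffians_sqn_le (R : realFieldType) (x : nat -> R) :
  4 * pfaffians_sqn x <= sqn x ^+ 2.
Proof.
rewrite /pfaffians_sqn /sqn.
move: (x 0) (x 1) (x 2) (x 3) (x 4) (x 5) (x 6) (x 7) (x 8) (x 9).
move=> x12 x13 x14 x15 x23 x24 x25 x34 x35 x45.
set v1 := x23 * x45 - _ + _; set v2 := - x13 * x45 + _ - _.
set v3 := x12 * x45 - _ + _; set v4 := - x12 * x35 + _ - _.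
set v5 := x12 * x34 - _ + _.
(* [K1] to [K5] are the five components of [i_v w = 0]. *)
have K1 : x12 * v2 + x13 * v3 + x14 * v4 + x15 * v5 = 0.
  by rewrite /v2 /v3 /v4 /v5; ring.
have K2 : - x12 * v1 + x23 * v3 + x24 * v4 + x25 * v5 = 0.
  by rewrite /v1 /v3 /v4 /v5; ring.
have K3 : - x13 * v1 - x23 * v2 + x34 * v4 + x35 * v5 = 0.
  by rewrite /v1 /v2 /v4 /v5; ring.
have K4 : - x14 * v1 - x24 * v2 - x34 * v3 + x45 * v5 = 0.
  by rewrite /v1 /v2 /v3 /v5; ring.
have K5 : - x15 * v1 - x25 * v2 - x35 * v3 - x45 * v4 = 0.
  by rewrite /v1 /v2 /v3 /v4; ring.
pose p := v1 ^+ 2 + v2 ^+ 2 + v3 ^+ 2 + v4 ^+ 2 + v5 ^+ 2.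
pose n := x12 ^+ 2 + x13 ^+ 2 + x14 ^+ 2 + x15 ^+ 2 + x23 ^+ 2
  + x24 ^+ 2 + x25 ^+ 2 + x34 ^+ 2 + x35 ^+ 2 + x45 ^+ 2.
pose W12 := x34 * v5 - x35 * v4 + x45 * v3.
pose W13 := x25 * v4 - x24 * v5 - x45 * v2.
pose W14 := x23 * v5 - x25 * v3 + x35 * v2.
pose W15 := x24 * v3 - x23 * v4 - x34 * v2.
pose W23 := x14 * v5 - x15 * v4 + x45 * v1.
pose W24 := x15 * v3 - x13 * v5 - x35 * v1.
pose W25 := x13 * v4 - x14 * v3 + x34 * v1.
pose W34 := x12 * v5 - x15 * v2 + x25 * v1.
pose W35 := x14 * v2 - x12 * v4 - x24 * v1.
pose W45 := x12 * v3 - x13 * v2 + x23 * v1.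
have wW : x12 * W12 + x13 * W13 + x14 * W14 + x15 * W15 + x23 * W23
    + x24 * W24 + x25 * W25 + x34 * W34 + x35 * W35 + x45 * W45 = 2 * p.
  rewrite /p /W12 /W13 /W14 /W15 /W23 /W24 /W25 /W34 /W35 /W45.
  by rewrite /v1 /v2 /v3 /v4 /v5; ring.
have WW : W12 ^+ 2 + W13 ^+ 2 + W14 ^+ 2 + W15 ^+ 2 + W23 ^+ 2
    + W24 ^+ 2 + W25 ^+ 2 + W34 ^+ 2 + W35 ^+ 2 + W45 ^+ 2 = n * p.
  (* With [|i_v w|^2] subtracted, the identity holds for arbitrary [v]; clearing the bodies of [v1]
     to [v5] lets [ring] treat them as variables. *)
  transitivity (n * p - (x12 * v2 + x13 * v3 + x14 * v4 + x15 * v5) ^+ 2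
    - (- x12 * v1 + x23 * v3 + x24 * v4 + x25 * v5) ^+ 2
    - (- x13 * v1 - x23 * v2 + x34 * v4 + x35 * v5) ^+ 2
    - (- x14 * v1 - x24 * v2 - x34 * v3 + x45 * v5) ^+ 2
    - (- x15 * v1 - x25 * v2 - x35 * v3 - x45 * v4) ^+ 2).
    rewrite /W12 /W13 /W14 /W15 /W23 /W24 /W25 /W34 /W35 /W45 /n /p.
    by clearbody v1 v2 v3 v4 v5; ring.
  by rewrite K1 K2 K3 K4 K5; ring.
change (4 * p <= n ^+ 2).
have key s : 0 <= s ^+ 2 * n - 2 * s * (2 * p) + n * p.
  rewrite -wW -WW.
  have sq w W : 0 <= (s * w - W) ^+ 2 := sqr_ge0 _.
  have := addr_ge0 (addr_ge0 (addr_ge0 (addr_ge0 (addr_ge0 (addr_ge0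
    (addr_ge0 (addr_ge0 (addr_ge0 (sq x12 W12) (sq x13 W13)) (sq x14 W14))
    (sq x15 W15)) (sq x23 W23)) (sq x24 W24)) (sq x25 W25)) (sq x34 W34))
    (sq x35 W35)) (sq x45 W45).
  congr (0 <= _); rewrite /n.
  by clearbody p n W12 W13 W14 W15 W23 W24 W25 W34 W35 W45; ring.
have n0 : 0 <= n by rewrite /n !addr_ge0 ?sqr_ge0.
(* [s = 1] settles the case [n = 0], where it reads [0 <= - 4 * p]; otherwise [s = n / 2] gives
   [0 <= n * (n ^+ 2 - 4 * p)]. *)
have [key1 key2] := (key 1, key (n / 2)).
clearbody n p.
have [n_eq0|n_neq0] := eqVneq n 0; first by move: key1; rewrite n_eq0; lra.
have n_gt0 : 0 < n by rewrite lt_def n_neq0.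
rewrite -subr_ge0 -(pmulr_rge0 _ n_gt0).
suff -> : n * (n ^+ 2 - 4 * p)
  = 4 * ((n / 2) ^+ 2 * n - 2 * (n / 2) * (2 * p) + n * p).
  by rewrite mulr_ge0 ?key2.
by field.
Qed.

(** * Evaluation in coordinates and the cone over [Mminus] *)

Section Coordinates.
Variable R : realType.
Implicit Types x : 'rV[R]_10.

Definition coord x (k : nat) : R := x ord0 (inord k).

Lemma sum_sqr_coord x : \sum_(i < 10) x ord0 i ^+ 2 = sqn (coord x).
Proof.
rewrite (eq_bigr (fun i : 'I_10 => coord x i ^+ 2)) => [|i _].
  by rewrite !big_ord_recr big_ord0 /= add0r.
by rewrite /coord inord_val.
Qed.

Lemma meval_sqnorm x : (sqnorm R 10).@[x ord0] = sqn (coord x).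
Proof.
rewrite /sqnorm raddf_sum -sum_sqr_coord; apply: eq_bigr => i _.
by rewrite /= expr2 mevalM mevalXU.
Qed.

Lemma meval_isoF x :
  (isoF R).@[x ord0] = sqn (coord x) ^+ 2 - 8 * pfaffians_sqn (coord x).
Proof.
rewrite /isoF !expr2 mevalB !mevalM meval_sqnorm.
rewrite -(@mpolyC_nat 10 R 8) mevalC.
by rewrite !(mevalD, mevalB, mevalN, mevalM, mevalXU) /pfaffians_sqn !expr2.
Qed.

Lemma meval_GFplus x :
  (GFplus R).@[x ord0] = 2 * (sqn (coord x) ^+ 2 - 4 * pfaffians_sqn (coord x)).
Proof.
by rewrite /GFplus mevalD expr2 mevalM meval_sqnorm meval_isoF; ring.
Qed.

Lemma psd_GFplus : psd_form 4 (GFplus R).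
Proof.
split=> [|x]; last first.
  by rewrite meval_GFplus mulr_ge0 // subr_ge0 pfaffians_sqn_le.
have X1 i : ('X_i : {mpoly R[10]}) \is 1.-homog by rewrite dhomogX /= mdeg1.
have X2 i j : ('X_i * 'X_j : {mpoly R[10]}) \is 2.-homog.
  by rewrite (@dhomogM _ _ _ 1 _ 1).
have sqr_homog (p : {mpoly R[10]}) : p \is 2.-homog -> p ^+ 2 \is 4.-homog.
  exact: dhomogMn.
have sqn_homog : sqnorm R 10 \is 2.-homog.
  by apply: rpred_sum => i _; rewrite expr2 X2.
rewrite /GFplus /isoF rpredD ?rpredB ?sqr_homog // mulr_natl rpredMn //.
by rewrite !rpredD // ?sqr_homog // !(rpredD, rpredB, rpredN, mulNr) // X2.
Qed.

Lemma Mminus_cone x :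
  @Mminus R x <-> sqn (coord x) = 1 /\ on_cone (coord x).
Proof.
rewrite /Mminus /unit_sphere /= /on_cone sum_sqr_coord meval_isoF.
split=> -[x1]; rewrite x1.
  by move=> E; split => //; apply/eqP; lra.
by move=> /eqP E; split => //; lra.
Qed.

(** The cone condition is homogeneous: a nonzero point of the cone scales to a point of [Mminus],
    and scaling by [k] multiplies [Q] by [k ^+ 2]. *)
Lemma cone_zero Q x :
  quadratic_form Q -> vanishes_on Q (@Mminus R) ->
  on_cone (coord x) -> Q.@[x ord0] = 0.
Proof.
move=> /homog2_mx_form[B _ ->] Q0 xc; rewrite meval_mx_form.
have [n0|n_neq0] := eqVneq (sqn (coord x)) 0.
  suff -> : x = 0 by rewrite !mul0mx mxE.
  move: n0; rewrite -sum_sqr_coord => /eqP.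
  rewrite psumr_eq0 => [/allP x0|i _]; last exact: sqr_ge0.
  apply/rowP => i; rewrite mxE; apply/eqP; rewrite -sqrf_eq0.
  exact: x0 (mem_index_enum i).
have n_gt0 : 0 < sqn (coord x).
  by rewrite lt_def n_neq0 -sum_sqr_coord sumr_ge0 // => i _; rewrite sqr_ge0.
pose k := (Num.sqrt (sqn (coord x)))^-1.
have k_neq0 : k != 0 by rewrite invr_eq0 sqrtr_eq0 -ltNge.
have k2 : k ^+ 2 = (sqn (coord x))^-1 by rewrite exprVn sqr_sqrtr // ltW.
have coordZ j : coord (k *: x) j = k * coord x j by rewrite /coord mxE.
have sqnZ : sqn (coord (k *: x)) = k ^+ 2 * sqn (coord x).
  by rewrite /sqn !coordZ; ring.
have pfZ : pfaffians_sqn (coord (k *: x)) = k ^+ 4 * pfaffians_sqn (coord x).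
  by rewrite /pfaffians_sqn !coordZ; ring.
have /Q0 : @Mminus R (k *: x).
  apply/Mminus_cone; split; first by rewrite sqnZ k2 mulVf.
  rewrite /on_cone sqnZ pfZ mulrCA -(eqP xc); apply/eqP; ring.
rewrite meval_mx_form mx_formZr => /eqP.
by rewrite mulf_eq0 sqrf_eq0 (negbTE k_neq0) => /eqP.
Qed.

End Coordinates.

(** * The Petersen graph and integer points of the cone *)

(* [k] counts from 0: coordinate [x_(k+1)] belongs to the pair [pair_of k]. *)
Definition pair_of (k : nat) : nat * nat :=
  nth (0, 0)%N [:: (1, 2); (1, 3); (1, 4); (1, 5); (2, 3);
                   (2, 4); (2, 5); (3, 4); (3, 5); (4, 5)]%N k.

Definition disjoint_pairs (p r : nat) : bool :=
  uniq [:: (pair_of p).1; (pair_of p).2; (pair_of r).1; (pair_of r).2].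

Definition sparse (a b c : int) (p s r k : nat) : int :=
  a * (k == p)%:R + b * (k == s)%:R + c * (k == r)%:R.

(** If [p] and [s] are distinct and disjoint from [r], they share an index, and
    [a e_p + b e_s + c e_r] has squared norm [a^2 + b^2 + c^2] and Pfaffian norm [(a^2 + b^2) c^2].
    The cone condition is thus [a^2 + b^2 = c^2], whence the Pythagorean triple. All cases are
    checked by computation. *)
Lemma petersen_cone (p s r : nat) : (p < 10)%N -> (s < 10)%N -> (r < 10)%N ->
  disjoint_pairs p r ->
  [&& on_cone (sparse 1 0 1 p s r), on_cone (sparse 1 0 (-1) p s r)
    & disjoint_pairs s r && (p != s) ==> on_cone (sparse 4 3 5 p s r)].
Proof.
have : all (fun p => all (fun s => all (fun r => disjoint_pairs p r ==>
  [&& on_cone (sparse 1 0 1 p s r), on_cone (sparse 1 0 (-1) p s r)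
    & disjoint_pairs s r && (p != s) ==> on_cone (sparse 4 3 5 p s r)])
  (iota 0 10)) (iota 0 10)) (iota 0 10).
  by vm_compute.
move=> /allP all_p p10 s10 r10 pr.
have /all_p/allP all_s : p \in iota 0 10 by rewrite mem_iota.
have /all_s/allP all_r : s \in iota 0 10 by rewrite mem_iota.
have /all_r/implyP : r \in iota 0 10 by rewrite mem_iota.
exact.
Qed.

(** Two distinct pairs that meet cover three of the five indices; the other two form [r]. *)
Lemma petersen_diameter (p s : nat) : (p < 10)%N -> (s < 10)%N -> p != s ->
  disjoint_pairs p s \/
  exists2 r, (r < 10)%N & disjoint_pairs p r && disjoint_pairs s r.
Proof.
have : all (fun p => all (fun s => (p == s) || disjoint_pairs p s ||
  has (fun r => disjoint_pairs p r && disjoint_pairs s r) (iota 0 10))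
  (iota 0 10)) (iota 0 10).
  by vm_compute.
move=> /allP all_p p10 s10 /negbTE ps.
have /all_p/allP all_s : p \in iota 0 10 by rewrite mem_iota.
have : s \in iota 0 10 by rewrite mem_iota.
move=> /all_s; rewrite ps orFb => /orP[|/hasP[r]]; first by left.
by rewrite mem_iota => r10 prs; right; exists r.
Qed.

Lemma on_cone_intr (R : realType) (f : nat -> int) (x : nat -> R) :
  (forall k, (k < 10)%N -> x k = (f k)%:~R) -> on_cone f -> on_cone x.
Proof.
move=> xE /eqP fc; apply/eqP.
have -> : sqn x = (sqn f)%:~R by rewrite /sqn !xE // !rmorphD /= !rmorphXn.
rewrite -rmorphXn /= fc rmorphM /=; congr (_ * _).
by rewrite /pfaffians_sqn !xE // !(rmorphB, rmorphD, rmorphN, rmorphM, rmorphXn).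
Qed.

(** * Quadratic forms vanishing on [Mminus], and the consequences *)

Lemma quadratic_form_eq0 (R : realType) (Q : {mpoly R[10]}) :
  quadratic_form Q -> vanishes_on Q (@Mminus R) -> Q = 0.
Proof.
move=> Qq Q0; have [B Bs QE] := homog2_mx_form Qq.
suff B0 : B = 0 by rewrite QE B0 mx_form0.
have cone_B (a b c : int) (p s r : 'I_10) : on_cone (sparse a b c p s r) ->
    a%:~R ^+ 2 * B p p + b%:~R ^+ 2 * B s s + c%:~R ^+ 2 * B r r
    + 2 * (a%:~R * b%:~R * B p s + a%:~R * c%:~R * B p r
           + b%:~R * c%:~R * B s r) = 0.
  move=> fc; rewrite -mx_form3 // -meval_mx_form -QE; apply: cone_zero => //.
  apply: on_cone_intr fc => k k10; rewrite /coord !mxE /= -!val_eqE /= inordK //.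
  by rewrite /sparse !rmorphD /= !rmorphM /= !rmorph_nat.
have adj0 (p r : 'I_10) : disjoint_pairs p r -> B p r = 0 /\ B r r = - B p p.
  (* The two points give [B p p + B r r + 2 * B p r = 0] and [B p p + B r r - 2 * B p r = 0]. The
     slot [s] has coefficient 0 and is filled with [p]. *)
  move=> pr; have /and3P[/cone_B + /cone_B + _] :=
    petersen_cone (ltn_ord p) (ltn_ord p) (ltn_ord r) pr.
  by rewrite !(rmorphN, rmorph1, rmorph0) /=; split; lra.
have diag0 : B ord0 ord0 = 0.
  have edge (p r : 'I_10) : disjoint_pairs p r -> B r r = - B p p by case/adj0.
  (* The 5-cycle is 12, 34, 15, 23, 45; its odd length gives [B ord0 ord0 = - B ord0 ord0]. *)
  pose v k (k10 : (k < 10)%N) := Ordinal k10.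
  have := edge ord0 (@v 7 isT) isT; have := edge (@v 7 isT) (@v 3 isT) isT.
  have := edge (@v 3 isT) (@v 4 isT) isT; have := edge (@v 4 isT) (@v 9 isT) isT.
  have := edge (@v 9 isT) ord0 isT; lra.
have common (p s : 'I_10) : p != s -> disjoint_pairs p s \/
    exists2 r : 'I_10, disjoint_pairs p r & disjoint_pairs s r.
  move=> /(petersen_diameter (ltn_ord p) (ltn_ord s))[|[r r10 /andP[pr sr]]].
    by left.
  by right; exists (Ordinal r10).
have diag (p : 'I_10) : B p p = 0.
  have [->//|p0] := eqVneq p ord0.
  have [/adj0[_]|[r /adj0[_ pr] /adj0[_]]] := common _ _ p0.
    by rewrite diag0 => /esym/eqP; rewrite oppr_eq0 => /eqP.
  by rewrite diag0; lra.
apply/matrixP => p s; rewrite mxE.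
have [->|ps] := eqVneq p s; first exact: diag.
have [/adj0[]//|[r pr sr]] := common _ _ ps.
have /and3P[_ _] := petersen_cone (ltn_ord p) (ltn_ord s) (ltn_ord r) pr.
(* Only the cross term [2 * (4 * 3 * B p s)] survives. *)
rewrite sr ps => /cone_B; rewrite !diag (adj0 _ _ pr).1 (adj0 _ _ sr).1.
rewrite !mulr0 !add0r !addr0 => /eqP.
by rewrite !mulf_eq0 !intr_eq0 pnatr_eq0 => /eqP.
Qed.

(** All Pfaffians vanish at the decomposable form [e_1]. This point witnesses both that [Mminus] is
    not the whole sphere and that [GFplus] is nonzero. *)
Lemma e1_on_sphere (R : realType) :
  unit_sphere (delta_mx ord0 ord0 : 'rV[R]_10) /\
  (isoF R).@[(delta_mx ord0 ord0 : 'rV[R]_10) ord0] = 1.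
Proof.
set x : 'rV_10 := delta_mx _ _.
have x0 k : (k < 10)%N -> coord x k = (k == 0)%N%:R.
  by move=> k10; rewrite /coord mxE -!val_eqE /= inordK.
have n1 : sqn (coord x) = 1 by rewrite /sqn !x0 //=; ring.
split; first by rewrite /unit_sphere /= sum_sqr_coord.
by rewrite meval_isoF n1 /pfaffians_sqn !x0 //=; ring.
Qed.

Theorem theorem3p3 (R : realType) :
  (forall Q : {mpoly R[10]},
     quadratic_form Q -> vanishes_on Q (@Mminus R) -> Q = 0%R)
  /\ ~ quadratic_set (@Mminus R)
  /\ (psd_form 4 (GFplus R) /\ ~ is_sos (GFplus R)).
Proof.
have [x1 Fx1] := e1_on_sphere R; set x := delta_mx _ _ in x1 Fx1.
split; first exact: quadratic_form_eq0.
split.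
  move=> [A [Aq AE]].
  (* All members of [A] vanish on [Mminus], hence are zero, so [A] would cut out the whole
     sphere. *)
  have : @Mminus R x.
    rewrite AE; split=> // Q AQ.
    suff -> : Q = 0 by rewrite meval0.
    apply: quadratic_form_eq0; first exact: Aq.
    by move=> y; rewrite AE => -[_]; exact.
  by move=> [_ /=]; rewrite Fx1; lra.
split; first exact: psd_GFplus.
move=> [s sE]; have [Gh _] := psd_GFplus R.
have GE (y : 'rV[R]_10) := sos_homog (y ord0) (Gh : _ \is 2.*2.-homog) sE.
have q0 q : q \in s -> pihomog mdeg 2 q = 0.
  move=> qs; apply: quadratic_form_eq0; first exact: pihomogP.
  move=> y /Mminus_cone[_ /eqP yc]; apply/eqP; rewrite -sqrf_eq0.
  have /esym/eqP := GE y; rewrite meval_GFplus yc subrr mulr0.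
  by rewrite psumr_eq0 => [/allP/(_ q qs)|p _]; rewrite ?sqr_ge0.
(* With all degree 2 parts zero, the sum of squares is 0 at [e_1], whereas [GFplus] takes the value
   2 there. *)
have := GE x; rewrite big_seq big1 => [|q /q0 ->]; last by rewrite meval0 expr0n.
rewrite /GFplus mevalD expr2 mevalM meval_sqnorm -sum_sqr_coord x1 Fx1; lra.
Qed.
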